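(* Let $A\subset\mathbb R^p$ be a self-similar fractal, fixed under $M$ similitudes with the same contraction ratio, let $d=\dim_H A$ and $s>d$. Let $n$ be a positive integer and $\mathfrak M=\{M^kn : k\ge1\}$. Then the following limit exists: $$\lim_{\mathfrak M\ni N\to\infty}\frac{\mathcal E_s(A,N)}{N^{1+s/d}}.$$
   Context: A similitude of $\mathbb R^p$ is a map $\psi(\boldsymbol x)=rO(\boldsymbol x)+\boldsymbol z$ with $O$ an orthogonal $p\times p$ matrix, $\boldsymbol z\in\mathbb R^p$, and contraction ratio $0<r<1$. A nonempty compact set $A\subset\mathbb R^p$ is a self-similar fractal with (fixed under) similitudes $\psi_1,\dots,\psi_M$ ($M\ge2$), with contraction ratios $r_1,\dots,r_M$, if $A=\bigcup_{m=1}^M\psi_m(A)$, where the union is disjoint. Its Hausdorff dimension $d=\dim_H A$ satisfies $\sum_{m=1}^M r_m^d=1$; when all ratios equal $r$, this reads $Mr^d=1$. For a finite set $\omega_N=\{\boldsymbol x_1,\dots,\boldsymbol x_N\}$ of $N$ distinct points, $E_s(\omega_N):=\sum_{i\ne j}|\boldsymbol x_i-\boldsymbol x_j|^{-s}$ (sum over ordered pairs), and for $N\ge2$, $\mathcal E_s(A,N):=\inf\{E_s(\omega_N):\omega_N\subset A,\ \#\omega_N=N\}$. *)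

(* Defs.v *)
From HB Require Import structures.
From mathcomp Require Import all_boot all_order all_algebra.
From mathcomp Require Import all_classical all_reals all_analysis.

Set Implicit Arguments.
Unset Strict Implicit.
Unset Printing Implicit Defensive.

Import Order.TTheory GRing.Theory Num.Theory.
Import numFieldNormedType.Exports.

Local Open Scope classical_set_scope.
Local Open Scope ring_scope.

(* Points of R^p are row vectors. The library norm on ['rV[R]_p] is the sup
   norm, so the Euclidean norm is defined here; both induce the same topology,
   and [compact] refers to the library topology. *)
Definition enorm (R : realType) (p : nat) (x : 'rV[R]_p) : R :=
  Num.sqrt (\sum_(i < p) x ord0 i ^+ 2).

(* An orthogonal map acts on row vectors by multiplication on the right. *)
Definition similitude (R : realType) (p : nat) (r : R)
    (psi : 'rV[R]_p -> 'rV[R]_p) : Prop :=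
  0 < r < 1 /\
  exists (O : 'M[R]_p) (z : 'rV[R]_p),
    O *m O^T = 1%:M /\ forall x, psi x = r *: (x *m O) + z.

Definition self_similar_fractal (R : realType) (p M : nat) (r : 'I_M -> R)
    (psi : 'I_M -> 'rV[R]_p -> 'rV[R]_p) (A : set 'rV[R]_p) : Prop :=
  [/\ (2 <= M)%N,
      forall m, similitude (r m) (psi m),
      A !=set0 /\ compact A,
      A = \bigcup_(m in [set: 'I_M]) (psi m @` A) &
      trivIset [set: 'I_M] (fun m => psi m @` A)].

(* Equal to -oo for the empty set. *)
Definition ediam (R : realType) (p : nat) (U : set 'rV[R]_p) : \bar R :=
  ereal_sup [set (enorm (xy.1 - xy.2))%:E | xy in U `*` U].

(* [diam U ^ t], with the convention that the empty set contributes 0, also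
   for [t = 0]; a nonempty set of diameter 0 contributes [0 `^ 0 = 1] then. *)
Definition ediam_pow (R : realType) (p : nat) (t : R) (U : set 'rV[R]_p) :
    \bar R :=
  if U == set0 then 0%E else poweR (ediam U) t.

Definition hausdorff_content (R : realType) (p : nat) (t delta : R)
    (A : set 'rV[R]_p) : \bar R :=
  ereal_inf [set (\sum_(0 <= i <oo) ediam_pow t (U i))%E |
    U in [set U : nat -> set 'rV[R]_p |
      (forall i, (ediam (U i) <= delta%:E)%E) /\
      A `<=` \bigcup_(i in [set: nat]) U i]].

(* The supremum is the limit as [delta] tends to 0, by monotonicity. *)
Definition hausdorff_measure (R : realType) (p : nat) (t : R)
    (A : set 'rV[R]_p) : \bar R :=
  ereal_sup [set hausdorff_content t delta A | delta in [set x : R | 0 < x]].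

Definition hausdorff_dim (R : realType) (p : nat) (A : set 'rV[R]_p) : \bar R :=
  ereal_inf [set t%:E |
    t in [set t : R | 0 <= t /\ hausdorff_measure t A = 0%E]].

Definition riesz_energy (R : realType) (p : nat) (s : R) (N : nat)
    (x : 'I_N -> 'rV[R]_p) : R :=
  \sum_(i < N) \sum_(j < N | j != i) enorm (x i - x j) `^ (- s).

(* N-point subsets of A are given as injective enumerations. The infimum is
   the real-valued one: it is the intended value as soon as A has at least N
   points, which holds for every N when A is infinite. *)
Definition min_energy (R : realType) (p : nat) (s : R) (A : set 'rV[R]_p)
    (N : nat) : R :=
  inf [set riesz_energy s x |
    x in [set x : 'I_N -> 'rV[R]_p | injective x /\ forall i, A (x i)]].

(* Main.v *)
Require Import Defs.
From HB Require Import structures.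
From mathcomp Require Import all_boot all_order all_algebra.
From mathcomp Require Import ring lra.
From mathcomp Require Import all_classical all_reals all_analysis.
Import Order.TTheory GRing.Theory Num.Theory.
Import numFieldNormedType.Exports.
Local Open Scope classical_set_scope.
Local Open Scope ring_scope.

Set Implicit Arguments.
Unset Strict Implicit.
Unset Printing Implicit Defensive.

(** The normalized energies [E(N) / N^(1 + s/d)] along [N = M^k n] are
    nonincreasing up to a summable error, and nonnegative, so they converge.

    Placing a copy of a near-optimal [N]-point configuration in each of the [M]
    pieces of the fractal gives [M N] points. Distances inside a piece are
    scaled by [r], and distances between different pieces are bounded below by
    a positive gap, since the pieces are compact and disjoint. Therefore
    [E(M N) <= M r^(-s) E(N) + C (M N)^2] ([min_energy_replicate]).

    Moran's equation [M r^d = 1] says that [M r^(-s) = M^(1 + s/d)], exactly the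
    factor by which the normalization grows. After division the error is a
    constant times [N^(1 - s/d)], which decays geometrically in [k] because
    [s > d]; [cvg_quasi_nonincreasing] concludes.

    Moran's equation is proved from the definition of the Hausdorff dimension
    ([moran_equation]). The upper bound comes from the covers by the pieces of
    each generation ([hausdorff_measure_eq0]). The lower bound, which also
    yields [d > 0], rests on [finite_ball_cover_sum]: a finite cover by balls of
    radii [rho_i] centred in the fractal satisfies [sum rho_i^t >= sigma^t] as
    soon as [M r^t >= 1], where [sigma] is the gap. This follows by induction on
    the number of balls, since a cover by small balls splits into covers of the
    individual pieces, which self-similarity turns into smaller covers of the
    whole fractal. Compactness extends it to countable covers
    ([hausdorff_measure_neq0]). *)

(** * Euclidean geometry of similitudes *)

Lemma continuousB_comp (R : realType) (T : topologicalType)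
    (V : normedModType R) (f g : T -> V) :
  continuous f -> continuous g -> continuous (fun t => f t - g t).
Proof. by move=> cf cg t; apply: cvgB; [exact: cf|exact: cg]. Qed.

(** Continuity from a modulus that depends on the difference only. It serves
    to deduce continuity for the library norm from an estimate in the Euclidean
    norm, so that equivalence constants between the norms never appear. *)
Lemma continuous_modulus (R : realType) (V W : normedModType R)
    (w : V -> R) (f : V -> W) :
  continuous w -> w 0 = 0 -> (forall x y, `|f x - f y| <= w (x - y)) ->
  continuous f.
Proof.
move=> cw w0 fw x.
have c0 : w (x - y) @[y --> x] --> 0.
  rewrite -w0 -(subrr x).
  apply: (@continuous_comp _ _ _ (fun y => x - y) w); last exact: cw.
  by apply: continuousB_comp => [|y]; [exact: cst_continuous|exact: cvg_id].
apply/cvgrPdist_lt => e e0; move/cvgrPdist_lt: c0 => /(_ _ e0).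
apply: filterS => y; rewrite sub0r normrN => wxy.
exact: le_lt_trans (fw _ _) (le_lt_trans (ler_norm _) wxy).
Qed.

Lemma enorm_ge0 (R : realType) (p : nat) (x : 'rV[R]_p) : 0 <= enorm x.
Proof. exact: sqrtr_ge0. Qed.

(** Through this comparison, separation in the sup norm, which compactness
    provides, passes to the Euclidean norm. *)
Lemma sup_norm_le_enorm (R : realType) (p : nat) (x : 'rV[R]_p) :
  `|x| <= enorm x.
Proof.
rewrite [leLHS]mx_normrE; apply/bigmax_leP; split => [|[i j] _ /=].
  exact: enorm_ge0.
rewrite ord1 -sqrtr_sqr; apply: ler_wsqrtr.
by rewrite (bigD1 j)//= lerDl sumr_ge0// => k _; exact: sqr_ge0.
Qed.

Lemma enorm_gt0 (R : realType) (p : nat) (x : 'rV[R]_p) :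
  x != 0 -> 0 < enorm x.
Proof.
by move=> x0; rewrite (lt_le_trans _ (sup_norm_le_enorm x))// normr_gt0.
Qed.

Lemma enorm0 (R : realType) (p : nat) : enorm (0 : 'rV[R]_p) = 0.
Proof.
by rewrite /enorm big1 ?sqrtr0// => i _; rewrite mxE expr0n.
Qed.

Lemma continuous_enorm (R : realType) (p : nat) :
  continuous (@enorm R p).
Proof.
move=> x; apply: (@continuous_comp _ _ _ (fun y : 'rV[R]_p =>
  \sum_(i < p) y ord0 i ^+ 2) Num.sqrt); last exact: sqrt_continuous.
move: x; suff cs t : continuous (fun y : 'rV[R]_p => \sum_(i <- t) y ord0 i ^+ 2).
  exact: cs.
elim: t => [|i t IHt].
  by under eq_fun do rewrite big_nil; exact: cst_continuous.
under eq_fun do rewrite big_cons; move=> x; apply: cvgD (IHt x).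
by apply: (@continuous_comp _ _ _ (fun y : 'rV[R]_p => y ord0 i)
  (fun a : R => a ^+ 2)); [exact: coord_continuous|exact: exprn_continuous].
Qed.

(** Writing the squared norm as [u *m u^T] turns orthogonality into a
    cancellation of the two copies of the matrix. *)
Lemma enorm_similitude (R : realType) (p : nat) (r : R)
    (psi : 'rV[R]_p -> 'rV[R]_p) (x y : 'rV[R]_p) :
  similitude r psi -> enorm (psi x - psi y) = r * enorm (x - y).
Proof.
move=> [/andP[r0 _] [Q [z [QQ psiE]]]].
have sqE (u : 'rV[R]_p) : \sum_(i < p) u ord0 i ^+ 2 = (u *m u^T) ord0 ord0.
  by rewrite mxE; apply: eq_bigr => i _; rewrite mxE expr2.
have -> : psi x - psi y = r *: ((x - y) *m Q).
  by rewrite !psiE mulmxBl scalerBr opprD addrACA subrr addr0.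
rewrite /enorm !sqE linearZ/= -scalemxAl -scalemxAr scalerA trmx_mul mulmxA.
rewrite -(mulmxA (x - y)) QQ mulmx1 mxE sqrtrM ?mulr_ge0 ?ltW//.
by rewrite -expr2 sqrtr_sqr gtr0_norm.
Qed.

Lemma similitude_inj (R : realType) (p : nat) (r : R)
    (psi : 'rV[R]_p -> 'rV[R]_p) : similitude r psi -> injective psi.
Proof.
move=> sim x y pxy; apply/eqP; rewrite -subr_eq0.
apply: contraT => /enorm_gt0 xy; have := enorm_similitude x y sim.
case: sim => /andP[r0 _] _.
by rewrite pxy subrr enorm0 => /esym/eqP; rewrite gt_eqF// mulr_gt0.
Qed.

Lemma continuous_similitude (R : realType) (p : nat) (r : R)
    (psi : 'rV[R]_p -> 'rV[R]_p) : similitude r psi -> continuous psi.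
Proof.
move=> sim; apply: (@continuous_modulus _ _ _ (fun x => r * enorm x)).
- move=> x; apply: (@continuous_comp _ _ _ (@enorm R p) ( *%R r)).
    exact: continuous_enorm.
  exact: mulrl_continuous.
- by rewrite enorm0 mulr0.
- by move=> x y; rewrite -(enorm_similitude _ _ sim) sup_norm_le_enorm.
Qed.

Lemma compact_enorm_bounded (R : realType) (p : nat) (A : set 'rV[R]_p) :
  compact A ->
  exists2 L : R, 0 < L & forall x y, A x -> A y -> enorm (x - y) <= L.
Proof.
move=> cA.
have cAA : compact [set enorm (xy.1 - xy.2) | xy in A `*` A].
  apply: continuous_compact (compact_setX cA cA).
  apply: continuous_subspaceT => xy.
  apply: (@continuous_comp _ _ _ (fun xy : 'rV[R]_p * 'rV[R]_p => xy.1 - xy.2)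
    (@enorm R p)); last exact: continuous_enorm.
  by apply: continuousB_comp => ?; [exact: cvg_fst|exact: cvg_snd].
have [L0 [_ bL]] := compact_bounded cAA.
exists (`|L0| + 1); first by rewrite ltr_wpDl.
move=> x y Ax Ay; have : L0 < `|L0| + 1.
  by rewrite (le_lt_trans (ler_norm _))// ltrDl.
move=> /bL/(_ (enorm (x - y)))/=; rewrite ger0_norm ?enorm_ge0//.
by apply; exists (x, y).
Qed.

(** The differences between points of two pieces form a compact set, the image
    of [A `*` A]; disjointness keeps 0 outside, hence so is a whole ball around
    0, uniformly over the finitely many pairs of pieces. *)
Lemma fractal_gap (R : realType) (p M : nat) (r : 'I_M -> R)
    (psi : 'I_M -> 'rV[R]_p -> 'rV[R]_p) (A : set 'rV[R]_p) :
  self_similar_fractal r psi A ->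
  exists2 sigma : R, 0 < sigma & forall m m' x y, m != m' -> A x -> A y ->
    sigma <= enorm (psi m x - psi m' y).
Proof.
move=> [_ sim [_ cA] _ tA].
pose K (mm : 'I_M * 'I_M) :=
  [set psi mm.1 xy.1 - psi mm.2 xy.2 | xy in A `*` A].
have cK mm : compact (K mm).
  apply: continuous_compact (compact_setX cA cA).
  apply: continuous_subspaceT; apply: continuousB_comp => xy.
    apply: (@continuous_comp _ _ _ fst (psi mm.1)); first exact: cvg_fst.
    exact: (continuous_similitude (sim _)).
  apply: (@continuous_comp _ _ _ snd (psi mm.2)); first exact: cvg_snd.
  exact: (continuous_similitude (sim _)).
pose V : normedModType R := 'rV[R]_p.
have nK mm : nbhs (0 : V) [set z | mm.1 != mm.2 -> ~ K mm z].
  have [_|mN] := eqVneq mm.1 mm.2; first exact: filterE.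
  have : nbhs (0 : V) (~` K mm).
    apply: open_nbhs_nbhs; split.
      by apply: closed_openC; apply: compact_closed => //; exact: norm_hausdorff.
    move=> [[x y] [/= Ax Ay] /eqP]; rewrite subr_eq0 => /eqP pxy.
    move/eqP: mN; apply; apply: (tA _ _ I I).
    by exists (psi mm.1 x); split; [exists x|exists y].
  by apply: filterS => z Kz _.
have : nbhs (0 : V) [set z | forall mm, mm.1 != mm.2 -> ~ K mm z].
  exact: (@filter_forall V _ (fun mm => [set z | mm.1 != mm.2 -> ~ K mm z])
    (nbhs (0 : V)) _ nK).
move=> /nbhs_ballP[e /= e0 eK].
exists e => // m m' x y mm' Ax Ay; rewrite leNgt; apply/negP => lte.
have : ball (0 : V) e (psi m x - psi m' y).
  rewrite -ball_normE/= sub0r normrN.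
  exact: (le_lt_trans (sup_norm_le_enorm _) lte).
by move/eK/(_ (m, m')) => /(_ mm'); apply; exists (x, y).
Qed.

(** * Lower bound for the dimension *)

Lemma fractal_image (R : realType) (p M : nat) (r : 'I_M -> R)
    (psi : 'I_M -> 'rV[R]_p -> 'rV[R]_p) (A : set 'rV[R]_p) (m : 'I_M)
    (x : 'rV[R]_p) :
  self_similar_fractal r psi A -> A x -> A (psi m x).
Proof.
by move=> [_ _ _ AE _] Ax; rewrite AE; exists m => //; exists x.
Qed.

Lemma fractal_preimage (R : realType) (p M : nat) (r : 'I_M -> R)
    (psi : 'I_M -> 'rV[R]_p -> 'rV[R]_p) (A : set 'rV[R]_p) (x : 'rV[R]_p) :
  self_similar_fractal r psi A -> A x ->
  exists mu : 'I_M * 'rV[R]_p, A mu.2 /\ psi mu.1 mu.2 = x.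
Proof.
by move=> [_ _ _ AE _]; rewrite {1}AE => -[m _ [u Au <-]]; exists (m, u).
Qed.

Lemma exists_neq_ord (M : nat) (m : 'I_M) :
  (2 <= M)%N -> exists m' : 'I_M, m != m'.
Proof.
move=> M2; have M0 : (0 < M)%N by exact: ltn_trans M2.
have [m0|m0] := eqVneq (m : nat) 0%N.
  by exists (Ordinal M2); apply/eqP => /(congr1 val)/=; rewrite m0.
by exists (Ordinal M0); apply: contra m0 => /eqP ->.
Qed.

(** This replaces the mass distribution principle for finite covers by balls
    centred in [A]. If some radius reaches the gap [sigma], its term suffices.
    Otherwise each ball meets only the piece containing its centre, so the
    balls split into [M] groups, and the group of index [m], pulled back by
    [psi m], covers [A] with radii divided by [r]. Each group is strictly
    smaller than the cover, because the other pieces need balls too; by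
    induction it contributes at least [r `^ t * sigma `^ t], and there are
    [M >= r `^ (- t)] groups. *)
Lemma finite_ball_cover_sum (R : realType) (p M : nat) (r : R)
    (psi : 'I_M -> 'rV[R]_p -> 'rV[R]_p) (A : set 'rV[R]_p) (sigma t : R) :
  self_similar_fractal (fun=> r) psi A ->
  0 < sigma ->
  (forall m m' x y, m != m' -> A x -> A y ->
    sigma <= enorm (psi m x - psi m' y)) ->
  0 <= t -> 1 <= M%:R * r `^ t ->
  forall s : seq ('rV[R]_p * R),
    (forall c, c \in s -> A c.1 /\ 0 < c.2) ->
    (forall x, A x -> exists2 c, c \in s & enorm (x - c.1) < c.2) ->
    sigma `^ t <= \sum_(c <- s) c.2 `^ t.
Proof.
move=> hA sigma0 gap t0 Mrt s.
have [M2 sim [[a Aa] _] _ _] := hA.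
have M0 : (0 < M)%N by exact: ltn_trans M2.
have /andP[r0 _] : 0 < r < 1 by case: (sim (Ordinal M0)).
have /choice[f fP] (u : 'rV[R]_p) : exists mu : 'I_M * 'rV[R]_p,
    A u -> A mu.2 /\ psi mu.1 mu.2 = u.
  have [Au|nAu] := pselect (A u); last by exists (Ordinal M0, u).
  by have [mu muP] := fractal_preimage hA Au; exists mu.
have [n] := ubnP (size s); elim: n s => // n IHn s ltsn sA cover.
have [/hasP[c cs /= sc]|/hasPn/= small] := boolP (has (fun c => sigma <= c.2) s).
  have : sigma `^ t <= c.2 `^ t.
    have [_ c0] := sA c cs.
    by apply: ge0_ler_powR => //; rewrite nnegrE ltW.
  move=> /le_trans; apply; rewrite (big_rem c)//=.
  by rewrite lerDl sumr_ge0// => *; exact: powR_ge0.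
(* A point near [psi m x] in the cover has its centre in the piece [m] by the
   gap, so the pulled-back ball contains [x]. *)
have coverm m x : A x -> exists c, [/\ c \in s, (f c.1).1 = m &
    enorm (x - (f c.1).2) < c.2 / r].
  move=> Ax; have [c cs xc] := cover _ (fractal_image m hA Ax).
  have [Ac _] := sA c cs; have [Afc psifc] := fP _ Ac.
  have fm : (f c.1).1 = m.
    apply/eqP; apply: contraT; rewrite eq_sym => mf.
    have := gap _ _ _ _ mf Ax Afc; rewrite psifc leNgt => /negP[].
    by rewrite (lt_trans xc)// ltNge small.
  exists c; split => //; rewrite ltr_pdivlMr// mulrC.
  by rewrite -(enorm_similitude _ _ (sim m)) -[in psi m (f _).2]fm psifc.
rewrite (partition_big (fun c => (f c.1).1) predT)//=.
apply: (@le_trans _ _ (\sum_(m < M) r `^ t * sigma `^ t)).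
  rewrite sumr_const card_ord -[_ *+ M]mulr_natl mulrA ler_peMl//.
  exact: powR_ge0.
apply: ler_sum => m _.
pose s_ := [seq ((f c.1).2, c.2 / r) | c <- s & (f c.1).1 == m].
have -> : \sum_(c <- s | (f c.1).1 == m) c.2 `^ t =
    r `^ t * \sum_(c <- s_) c.2 `^ t.
  rewrite big_map big_filter mulr_sumr big_seq_cond [RHS]big_seq_cond.
  apply: eq_bigr => c /andP[/sA[_ c0] _].
  by rewrite -powRM ?divr_ge0 ?ltW//= mulrCA divff ?mulr1// gt_eqF.
rewrite ler_wpM2l ?powR_ge0//; apply: IHn.
- rewrite size_map size_filter (leq_trans _ (ltsn : (size s <= n)%N))//.
  (* Some ball lies over a different piece, so the group of [m] is smaller. *)
  have [m' mm'] := exists_neq_ord m M2.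
  have [c [cs cm' _]] := coverm m' _ Aa.
  rewrite -(count_predC (fun c => (f c.1).1 == m) s) -addn1 leq_add2l -has_count.
  by apply/hasP; exists c => //=; rewrite cm' eq_sym.
- move=> _ /mapP[c + ->]; rewrite mem_filter => /andP[_ /sA[Ac c0]] /=.
  by split; [case: (fP _ Ac)|rewrite divr_gt0].
- move=> x Ax; have [c [cs cm xc]] := coverm m x Ax.
  exists ((f c.1).2, c.2 / r) => //; apply/mapP; exists c => //.
  by rewrite mem_filter cm eqxx.
Qed.

Lemma ediam_ge (R : realType) (p : nat) (U : set 'rV[R]_p) (x y : 'rV[R]_p) :
  U x -> U y -> ((enorm (x - y))%:E <= ediam U)%E.
Proof. by move=> Ux Uy; apply: ereal_sup_ubound; exists (x, y). Qed.

Lemma ediam_pow_ge0 (R : realType) (p : nat) (t : R) (U : set 'rV[R]_p) :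
  (0 <= ediam_pow t U)%E.
Proof. by rewrite /ediam_pow; case: ifP => // _; exact: poweR_ge0. Qed.

Lemma le1_powR_anti (R : realType) (a u t : R) :
  0 <= a <= 1 -> 0 < t -> u <= t -> a `^ t <= a `^ u.
Proof.
move=> /andP[a0 a1] t0 ut; move: a0; rewrite le_eqVlt => /predU1P[<-|a0].
  by rewrite powR0 ?gt_eqF// powR_ge0.
by apply: ger_powR => //; rewrite a0.
Qed.

Lemma powRVK (R : realType) (w t : R) : 0 <= w -> t != 0 -> (w `^ t^-1) `^ t = w.
Proof. by move=> w0 t0; rewrite -powRrM mulVf// powRr1. Qed.

(** Passing from arbitrary covers to open balls centred in [A]: the radius
    [(diam U `^ t + e) `^ (1 / t)] exceeds the diameter, so a ball around any
    point of [A `&` U] works, at an additive cost [e] in the sum of powers.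
    When [U] misses [A], the ball is only there to have the same index set.
    Allowing an exponent [u <= t] on the diameter, which is at most 1, treats all
    smaller exponents along with [t], including 0. *)
Lemma ball_of_set (R : realType) (p : nat) (A U : set 'rV[R]_p) (u t e : R) :
  A !=set0 -> (ediam U <= 1%:E)%E -> 0 < t -> u <= t -> 0 < e ->
  exists c : 'rV[R]_p * R, [/\ A c.1, 0 < c.2,
    forall x, A x -> U x -> enorm (x - c.1) < c.2 &
    ((c.2 `^ t)%:E <= ediam_pow u U + e%:E)%E].
Proof.
move=> [a Aa] U1 t0 ut e0; have tN0 : t != 0 by rewrite gt_eqF.
have [[v [Av Uv]]|nAU] := pselect (A `&` U !=set0); last first.
  exists (a, e `^ t^-1); split => //=; first exact: powR_gt0.
    by move=> x Ax Ux; case: nAU; exists x.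
  by rewrite powRVK ?(ltW e0)// leeDr// ediam_pow_ge0.
have D0 : (0 <= ediam U)%E.
  by have := ediam_ge Uv Uv; rewrite subrr enorm0.
have [D DE] : exists D, ediam U = D%:E.
  by case: (ediam U) U1 D0 => // D _ _; exists D.
move: D0 U1; rewrite DE !lee_fin => D0 D1.
have w0 : 0 < D `^ t + e by rewrite ltr_wpDl ?powR_ge0.
exists (v, (D `^ t + e) `^ t^-1); split => //=; first exact: powR_gt0.
  move=> x Ax Ux; apply: (@le_lt_trans _ _ D).
    by have := ediam_ge Ux Uv; rewrite DE lee_fin.
  rewrite ltNge; apply/negP => /(ge0_ler_powR (ltW t0)).
  rewrite !nnegrE powR_ge0 D0 => /(_ isT isT).
  by rewrite powRVK ?(ltW w0)// leNgt ltrDl e0.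
rewrite powRVK ?(ltW w0)// EFinD leeD2r// /ediam_pow ifF; last first.
  by apply/negbTE/set0P; exists v.
by rewrite DE poweR_EFin lee_fin le1_powR_anti// D0.
Qed.

(** The finite subcover extracted by compactness is indexed by an arbitrary
    finite set of integers rather than by an initial segment. *)
Lemma uniq_sum_le_nneseries (R : realType) (f : nat -> \bar R) (s : seq nat) :
  uniq s -> (forall i, 0 <= f i)%E ->
  (\sum_(i <- s) f i <= \sum_(0 <= i <oo) f i)%E.
Proof.
move=> us f0.
have [N sN] : exists N, forall i, i \in s -> (i < N)%N.
  exists (\max_(i <- s) i).+1 => i si.
  by rewrite ltnS (big_rem i)//= leq_maxl.
apply: le_trans (nneseries_lim_ge N _) => //.
rewrite [leLHS](perm_big [seq i <- iota 0 N | i \in s])/=; last first.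
  apply: uniq_perm => [||i]; [exact: us|exact: filter_uniq (iota_uniq _ _)|].
  rewrite mem_filter mem_iota add0n /=.
  by case: (boolP (i \in s)) => //= /sN ->.
rewrite big_filter /index_iota subn0.
by apply: lee_sum_nneg_subset => // i _.
Qed.

Lemma open_enorm_ball (R : realType) (p : nat) (v : 'rV[R]_p) (rho : R) :
  open [set x | enorm (x - v) < rho].
Proof.
suff : open ((fun x : 'rV[R]_p => enorm (x - v)) @^-1` [set y | y < rho]) by [].
have cv : continuous (fun x : 'rV[R]_p => enorm (x - v)).
  move=> x; apply: (@continuous_comp _ _ _ (fun x : 'rV[R]_p => x - v)
    (@enorm R p)); last exact: continuous_enorm.
  by apply: continuousB_comp => [y|]; [exact: cvg_id|exact: cst_continuous].
apply: open_comp => [x _|]; last exact: open_lt.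
exact: cv.
Qed.

(** A cover of small cost would, by enlargement to balls and compactness, give
    a finite cover contradicting [finite_ball_cover_sum]. *)
Lemma hausdorff_measure_neq0 (R : realType) (p M : nat) (r : R)
    (psi : 'I_M -> 'rV[R]_p -> 'rV[R]_p) (A : set 'rV[R]_p) (t u : R) :
  self_similar_fractal (fun=> r) psi A ->
  0 < t -> 1 <= M%:R * r `^ t -> u <= t ->
  hausdorff_measure u A <> 0%E.
Proof.
move=> hA t0 Mrt ut mu0.
have [sigma sigma0 gap] := fractal_gap hA.
have [_ _ [A0 cA] _ _] := hA.
have st0 : 0 < sigma `^ t by exact: powR_gt0.
(* The final cost is below [e + e], so any fraction up to 1/2 would do. *)
pose e := sigma `^ t / 4; have e0 : 0 < e by rewrite divr_gt0.
have : (hausdorff_content u 1 A < e%:E)%E.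
  apply: (@le_lt_trans _ _ 0%E); last by rewrite lte_fin.
  by rewrite -mu0; apply: ereal_sup_ubound; exists 1 => //=.
move=> /ereal_inf_lt[_ [U [Ud AU] <-] sumU].
have e_i i : 0 < e / (2 ^ i.+1)%:R by rewrite divr_gt0// ltr0n expn_gt0.
have /choice[c cP] i := ball_of_set A0 (Ud i) t0 ut (e_i i).
pose V i := [set x | enorm (x - (c i).1) < (c i).2].
have oV i : open (V i) by exact: open_enorm_ball.
have : finite_subset_cover [set: nat] V A.
  move: cA; rewrite compact_cover; apply => // x Ax.
  have [i _ Uix] := AU x Ax; exists i => //.
  by have [_ _ + _] := cP i; exact.
move=> [F _ AF].
have := @finite_ball_cover_sum _ _ _ _ _ _ sigma t hA sigma0 gap (ltW t0) Mrt
  [seq c i | i <- finmap.enum_fset F].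
rewrite big_map => /(_ _ _)/wrap[].
- by move=> _ /mapP[i _ ->]; have [] := cP i.
- by move=> x /AF[i /= iF Vix]; exists (c i) => //; apply/mapP; exists i.
apply/negP; rewrite -ltNge -lte_fin -sumEFin.
apply: (@le_lt_trans _ _ (\sum_(0 <= i <oo) ediam_pow u (U i) + e%:E)%E).
  apply: le_trans (epsilon_trick predT _ (ltW e0)); last first.
    by move=> i; exact: ediam_pow_ge0.
  apply: le_trans (uniq_sum_le_nneseries (finmap.fset_uniq F) _).
    by apply: lee_sum => i _; have [] := cP i.
  by move=> i; rewrite adde_ge0 ?ediam_pow_ge0// lee_fin ltW.
apply: (@lt_trans _ _ (e%:E + e%:E)%E); first by rewrite lteD2rE.
by rewrite -EFinD lte_fin /e; lra.
Qed.

(** * Upper bound for the dimension and Moran's equation *)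

(** The [M ^ k] pieces of generation [k], indexed by integers read in base [M]
    and padded with empty sets: the last digit of [i] selects the outermost
    similitude and [i %/ M] the piece of generation [k - 1]. *)
Lemma fractal_cell_cover (R : realType) (p M : nat) (r : R)
    (psi : 'I_M -> 'rV[R]_p -> 'rV[R]_p) (A : set 'rV[R]_p) (L : R) (k : nat) :
  self_similar_fractal (fun=> r) psi A ->
  (forall x y, A x -> A y -> enorm (x - y) <= L) ->
  exists U : nat -> set 'rV[R]_p, [/\ A `<=` \bigcup_i U i,
    forall i, (M ^ k <= i)%N -> U i = set0 &
    forall i x y, U i x -> U i y -> enorm (x - y) <= r ^+ k * L].
Proof.
move=> hA AL; have [M2 sim _ _ _] := hA.
have M0 : (0 < M)%N by exact: ltn_trans M2.
elim: k => [|k [U [AU U0 dU]]].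
  exists (fun i => if i == 0%N then A else set0); split.
  - by move=> x Ax; exists 0%N.
  - by case.
  - by case=> [|i] /= x y; rewrite ?inE // expr0 mul1r; exact: AL.
pose dig i : 'I_M := Ordinal (ltn_pmod i M0).
exists (fun i => psi (dig i) @` U (i %/ M)%N); split.
- move=> x /(fractal_preimage hA)[[m u] /= [Au <-]].
  have [j _ Uju] := AU u Au; exists (j * M + m)%N => //.
  have -> : dig (j * M + m)%N = m.
    by apply: val_inj; rewrite /= modnMDl modn_small.
  by exists u => //; rewrite divnMDl// divn_small// addn0.
- by move=> i Mi; rewrite U0 ?image_set0// leq_divRL// mulnC -expnS.
- move=> i _ _ [x Ux <-] [y Uy <-]; have [/andP[r0 _] _] := sim (dig i).
  rewrite (enorm_similitude _ _ (sim _)) exprS -mulrA ler_pM2l//.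
  exact: dU Ux Uy.
Qed.

Lemma ediam_pow_le (R : realType) (p : nat) (t b : R) (U : set 'rV[R]_p) :
  0 <= t -> 0 <= b -> (ediam U <= b%:E)%E -> (ediam_pow t U <= (b `^ t)%:E)%E.
Proof.
move=> t0 b0; rewrite /ediam_pow; have [_|/set0P[x Ux]] := eqVneq U set0.
  by rewrite lee_fin powR_ge0.
have := ediam_ge Ux Ux; rewrite subrr enorm0.
case: (ediam U) => //= D; rewrite !lee_fin => D0 Db.
by apply: ge0_ler_powR.
Qed.

Lemma finite_cover_content (R : realType) (p : nat) (A : set 'rV[R]_p)
    (U : nat -> set 'rV[R]_p) (n : nat) (t delta b : R) :
  0 <= t -> 0 <= b -> b <= delta -> A `<=` \bigcup_i U i ->
  (forall i, (n <= i)%N -> U i = set0) ->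
  (forall i x y, U i x -> U i y -> enorm (x - y) <= b) ->
  (hausdorff_content t delta A <= (n%:R * b `^ t)%:E)%E.
Proof.
move=> t0 b0 bd AU U0 Ub.
have diamU i : (ediam (U i) <= b%:E)%E.
  by apply: ge_ereal_sup => _ [[x y] [/= Ux Uy] <-]; rewrite lee_fin (Ub i).
apply: (@le_trans _ _ (\sum_(0 <= i <oo) ediam_pow t (U i))%E).
  apply: ereal_inf_lbound; exists U => //; split => // i.
  by apply: le_trans (diamU i) _; rewrite lee_fin.
rewrite (nneseries_split 0 n) => [|i _]; last exact: ediam_pow_ge0.
rewrite add0n [X in (_ + X)%E]eseries0 ?adde0 => [|i ni _]; last first.
  by rewrite /ediam_pow U0// eqxx.
apply: (@le_trans _ _ (\sum_(0 <= i < n) (b `^ t)%:E)%E).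
  by apply: lee_sum => i _; exact: ediam_pow_le.
by rewrite sumEFin big_const_nat subn0 iter_addr_0 mulr_natl.
Qed.

(** Covering by the pieces of generation [k] costs at most
    [(M * r `^ t) ^+ k * L `^ t], where [L] bounds the distances in [A]: a
    vanishing geometric sequence. *)
Lemma hausdorff_measure_eq0 (R : realType) (p M : nat) (r : R)
    (psi : 'I_M -> 'rV[R]_p -> 'rV[R]_p) (A : set 'rV[R]_p) (t : R) :
  self_similar_fractal (fun=> r) psi A ->
  0 <= t -> M%:R * r `^ t < 1 -> hausdorff_measure t A = 0%E.
Proof.
move=> hA t0 Mrt; have [M2 sim [_ cA] _ _] := hA.
have M0 : (0 < M)%N by exact: ltn_trans M2.
have /andP[r0 r1] : 0 < r < 1 by case: (sim (Ordinal M0)).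
have [L L0 AL] := compact_enorm_bounded cA.
have content0 delta : 0 < delta -> hausdorff_content t delta A = 0%E.
  move=> delta0; apply/eqP; rewrite eq_le; apply/andP; split; last first.
    apply: le_ereal_inf_tmp => _ [U _ <-].
    by apply: nneseries_ge0 => i _ _; exact: ediam_pow_ge0.
  apply/lee_addgt0Pr => e e0; rewrite add0e.
  have [k [kdelta ke]] : exists k, r ^+ k * L <= delta /\
      (M%:R * r `^ t) ^+ k * L `^ t <= e.
    have small a q c : 0 <= q -> q < 1 -> 0 < c ->
        \forall k \near \oo, q ^+ k * a <= c :> R.
      move=> q0 q1 c0.
      have : geometric a q k @[k --> \oo] --> 0.
        by apply: cvg_geometric; rewrite ger0_norm.
      move=> /cvgrPdist_lt/(_ _ c0); apply: filterS => k.
      by rewrite sub0r normrN mulrC => /ltW; exact: le_trans (ler_norm _).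
    have Mrt0 : 0 <= M%:R * r `^ t by rewrite mulr_ge0// powR_ge0.
    near \oo => k; exists k; split; near: k.
      by apply: small => //; exact: ltW.
    exact: small.
  have [U [AU U0 dU]] := fractal_cell_cover k hA AL.
  have rk0 : 0 <= r ^+ k by rewrite exprn_ge0// ltW.
  apply: le_trans (finite_cover_content t0 _ kdelta AU U0 dU) _.
    by rewrite mulr_ge0// ltW.
  rewrite lee_fin (le_trans _ ke)// powRM// ?(ltW L0)//.
  rewrite exprMn natrX -[r `^ t ^+ k]powR_mulrn ?powR_ge0//.
  by rewrite -[r ^+ k]powR_mulrn ?(ltW r0)// powRAC mulrA.
apply/eqP; rewrite eq_le; apply/andP; split.
  by apply: ge_ereal_sup => _ [delta /= delta0 <-]; rewrite content0.
by apply: ereal_sup_ubound; exists 1 => //=; rewrite content0.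
Unshelve. all: by end_near. Qed.

(** Both bounds meet at [D = ln M / - ln r], the solution of
    [M * r `^ D = 1]: the measure vanishes for exponents above [D] and does not
    vanish for exponents up to [D]. *)
Lemma moran_equation (R : realType) (p M : nat) (r : R)
    (psi : 'I_M -> 'rV[R]_p -> 'rV[R]_p) (A : set 'rV[R]_p) (d : R) :
  self_similar_fractal (fun=> r) psi A -> hausdorff_dim A = d%:E ->
  0 < d /\ M%:R * r `^ d = 1.
Proof.
move=> hA hd; have [M2 sim _ _ _] := hA.
have M0 : (0 < M)%N by exact: ltn_trans M2.
have /andP[r0 r1] : 0 < r < 1 by case: (sim (Ordinal M0)).
have M1 : 1 < M%:R :> R by rewrite ltr1n.
have lr0 : 0 < - ln r by rewrite oppr_gt0 ln_lt0// r0.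
pose D := ln M%:R / - ln r.
have D0 : 0 < D by rewrite divr_gt0// ln_gt0.
have MrD : M%:R * r `^ D = 1.
  rewrite /powR gt_eqF// /D invrN mulrN mulNr divfK; last first.
    by rewrite -oppr_eq0 gt_eqF.
  by rewrite expRN lnK ?posrE ?ltr0n// divff// pnatr_eq0 -lt0n.
suff -> : d = D by [].
apply/eqP; rewrite eq_le; apply/andP; split.
  apply/ler_addgt0Pr => e e0; rewrite -lee_fin -hd.
  apply: ereal_inf_lbound; exists (D + e) => //; split.
    by rewrite addr_ge0 ?(ltW D0)// ltW.
  have De0 : 0 <= D + e by rewrite addr_ge0 ?(ltW D0)// ltW.
  apply: (hausdorff_measure_eq0 hA) => //.
  rewrite powRD ?gt_eqF ?addr_gt0//= mulrA MrD mul1r.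
  by rewrite /powR gt_eqF// -expR0 ltr_expR pmulr_rlt0// -oppr_gt0.
rewrite -lee_fin -hd; apply: le_ereal_inf_tmp => _ [t [t0 mut] <-].
rewrite lee_fin leNgt; apply/negP => tD.
by apply: (hausdorff_measure_neq0 hA D0 _ (ltW tD) mut); rewrite MrD.
Qed.

(** * Energy of replicated configurations *)

Lemma powRN_le_anti (R : realType) (sigma c s : R) :
  0 <= s -> 0 < sigma -> sigma <= c -> c `^ (- s) <= sigma `^ (- s).
Proof.
move=> s0 sigma0 sc; have c0 : 0 < c by exact: lt_le_trans sc.
rewrite !powRN lef_pV2 ?posrE ?powR_gt0//.
by rewrite ge0_ler_powR// nnegrE ltW.
Qed.

Lemma riesz_energy_ge0 (R : realType) (p : nat) (s : R) (N : nat)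
  (x : 'I_N -> 'rV[R]_p) : 0 <= riesz_energy s x.
Proof. by do 2! (apply: sumr_ge0 => ? _); exact: powR_ge0. Qed.

(** Put a copy of the configuration in each of the [M] pieces. Pairs inside one
    piece contribute the old energy scaled by [r `^ (- s)]; pairs in different
    pieces are at distance at least [sigma], and there are at most
    [(M * N) ^ 2] of them. *)
Lemma energy_replicate (R : realType) (p M N : nat) (r s sigma : R)
    (psi : 'I_M -> 'rV[R]_p -> 'rV[R]_p) (A : set 'rV[R]_p)
    (x : 'I_N -> 'rV[R]_p) :
  self_similar_fractal (fun=> r) psi A -> 0 <= s -> 0 < sigma ->
  (forall m m' x y, m != m' -> A x -> A y ->
    sigma <= enorm (psi m x - psi m' y)) ->
  injective x -> (forall i, A (x i)) ->
  exists y : 'I_(M * N) -> 'rV[R]_p, [/\ injective y, forall k, A (y k) &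
    riesz_energy s y <= M%:R * r `^ (- s) * riesz_energy s x +
      (M * N)%:R ^+ 2 * sigma `^ (- s)].
Proof.
move=> hA s0 sigma0 gap xI xA; have [M2 sim _ _ _] := hA.
have M0 : (0 < M)%N by exact: ltn_trans M2.
have /andP[r0 r1] : 0 < r < 1 by case: (sim (Ordinal M0)).
(* The [M * N] new points are naturally indexed by pairs (piece, old point);
   [idx] is the bijection used to flatten matrices. *)
pose idx := uncurry (@mxvec_index M N).
have [g idxK gK] : bijective idx.
  have [g idxK gK] := curry_mxvec_bij M N.
  by exists g => [a|k]; [exact: idxK|exact: gK].
have idx_bij : bijective idx by exists g.
pose z (a : 'I_M * 'I_N) := psi a.1 (x a.2).
have zI : injective z.
  move=> [m i] [m' j]; rewrite /z /= => zz.
  have mm' : m = m'.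
    apply/eqP; apply: contraT => /gap/(_ (xA i) (xA j)).
    by rewrite zz subrr enorm0 leNgt sigma0.
  by move: zz; rewrite mm' => /(similitude_inj (sim _))/xI ->.
exists (z \o g); split.
- by move=> k l /= /zI; exact: (can_inj gK).
- by move=> k; exact: fractal_image hA (xA _).
rewrite /riesz_energy.
have -> : \sum_(k < M * N) \sum_(l < M * N | l != k)
      enorm ((z \o g) k - (z \o g) l) `^ (- s) =
    \sum_a \sum_(b | b != a) enorm (z a - z b) `^ (- s).
  rewrite (reindex _ (onW_bij _ idx_bij)); apply: eq_bigr => a _.
  rewrite (reindex _ (onW_bij _ idx_bij)); apply: eq_big => [b|b _].
    by rewrite (bij_eq idx_bij).
  by rewrite /comp !idxK.
have -> : M%:R * r `^ (- s) * \sum_(i < N) \sum_(j < N | j != i)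
      enorm (x i - x j) `^ (- s) =
    \sum_(a : 'I_M * 'I_N) \sum_(j < N | j != a.2)
      (r * enorm (x a.2 - x j)) `^ (- s).
  rewrite -(pair_bigA _ (fun _ i => \sum_(j < N | j != i)
    (r * enorm (x i - x j)) `^ (- s)))/= sumr_const card_ord.
  rewrite -mulrA -[RHS]mulr_natl; congr (_ * _).
  rewrite mulr_sumr; apply: eq_bigr => i _.
  rewrite mulr_sumr; apply: eq_bigr => j _.
  by rewrite powRM ?(ltW r0)// enorm_ge0.
have -> : (M * N)%:R ^+ 2 * sigma `^ (- s) =
    \sum_(a : 'I_M * 'I_N) \sum_(b : 'I_M * 'I_N) sigma `^ (- s).
  by rewrite !sumr_const card_prod !card_ord -mulrnA -[RHS]mulr_natl !natrM expr2.
rewrite -big_split/=; apply: ler_sum => a _.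
rewrite (bigID (fun b : 'I_M * 'I_N => b.1 == a.1))/=; apply: lerD.
  rewrite (reindex_onto (fun j => (a.1, j)) snd)/=; last first.
    by move=> [m j]/= /andP[_ /eqP ->].
  rewrite le_eqVlt; apply/predU1P; left; apply: eq_big => [j|j _].
    by case: (a) => m i; rewrite /= xpair_eqE !eqxx andbT andTb andbT.
  by rewrite /z /= (enorm_similitude _ _ (sim _)).
rewrite [leRHS](bigID (fun b : 'I_M * 'I_N => (b != a) && (b.1 != a.1)))/=.
rewrite ler_wpDr ?sumr_ge0// => [*|]; first exact: powR_ge0.
apply: ler_sum => b /andP[_ ba]; apply: powRN_le_anti => //.
by apply: gap => //; rewrite eq_sym.
Qed.

(** Replicating a single point [N] times yields [M ^ N >= N] distinct points.
    This makes the infimum in [min_energy] range over a nonempty set. *)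
Lemma fractal_configurations (R : realType) (p M : nat) (r : R)
    (psi : 'I_M -> 'rV[R]_p -> 'rV[R]_p) (A : set 'rV[R]_p) (N : nat) :
  self_similar_fractal (fun=> r) psi A ->
  exists x : 'I_N -> 'rV[R]_p, injective x /\ forall i, A (x i).
Proof.
move=> hA; have [M2 _ [[a Aa] _] _ _] := hA.
have [sigma sigma0 gap] := fractal_gap hA.
have [x [xI xA]] : exists x : 'I_(M ^ N) -> 'rV[R]_p,
    injective x /\ forall i, A (x i).
  elim: N => [|k [x [xI xA]]].
    by exists (fun=> a); split => // i j _; rewrite [i]ord1 [j]ord1.
  have [y [yI yA _]] := energy_replicate hA (lexx 0) sigma0 gap xI xA.
  by rewrite expnS; exists y.
have NM : (N <= M ^ N)%N by apply/ltnW/ltn_expl.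
exists (x \o widen_ord NM); split => [i j /xI/(congr1 val)/= ij|i]; last exact: xA.
exact: val_inj.
Qed.

Lemma min_energy_ge0 (R : realType) (p : nat) (s : R) (A : set 'rV[R]_p)
  (N : nat) : 0 <= min_energy s A N.
Proof.
have [S0|/set0P S0] := eqVneq [set riesz_energy s x |
    x in [set x : 'I_N -> 'rV[R]_p | injective x /\ forall i, A (x i)]] set0.
  by rewrite /min_energy S0 inf0.
by apply: lb_le_inf => // _ [x _ <-]; exact: riesz_energy_ge0.
Qed.

(** The gap depends on the fractal alone, so the bound of [energy_replicate]
    passes to the infimum with one constant for all [N]. *)
Lemma min_energy_replicate (R : realType) (p M : nat) (r s : R)
    (psi : 'I_M -> 'rV[R]_p -> 'rV[R]_p) (A : set 'rV[R]_p) :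
  self_similar_fractal (fun=> r) psi A -> 0 <= s ->
  exists2 C : R, 0 <= C & forall N, min_energy s A (M * N) <=
    M%:R * r `^ (- s) * min_energy s A N + (M * N)%:R ^+ 2 * C.
Proof.
move=> hA s0; have [M2 sim _ _ _] := hA.
have M0 : (0 < M)%N by exact: ltn_trans M2.
have /andP[r0 r1] : 0 < r < 1 by case: (sim (Ordinal M0)).
have [sigma sigma0 gap] := fractal_gap hA.
exists (sigma `^ (- s)); first exact: powR_ge0.
move=> N; have a0 : 0 < M%:R * r `^ (- s) by rewrite mulr_gt0 ?ltr0n// powR_gt0.
rewrite -lerBlDr -ler_pdivrMl//; apply: lb_le_inf.
  have [x xA] := fractal_configurations N hA.
  by exists (riesz_energy s x), x.
move=> _ [x [xI xA] <-]; rewrite ler_pdivrMl// lerBlDr.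
have [y [yI yA yE]] := energy_replicate hA s0 sigma0 gap xI xA.
apply: le_trans yE; apply: ge_inf; last by exists y.
by exists 0 => _ [w _ <-]; exact: riesz_energy_ge0.
Qed.

(** * Convergence along the subsequence *)

(** Adding the tail [c q^k / (1 - q)] of the error series to [u k] gives a
    nonincreasing nonnegative sequence, and that tail tends to 0. *)
Lemma cvg_quasi_nonincreasing (R : realType) (u : R^nat) (c q : R) :
  0 <= c -> 0 <= q < 1 -> (forall k, 0 <= u k) ->
  (forall k, u k.+1 <= u k + c * q ^+ k) ->
  exists l : R, u @ \oo --> l.
Proof.
move=> c0 /andP[q0 q1] u0 uS; have q1' : 0 < 1 - q by rewrite subr_gt0.
pose g k := geometric (c / (1 - q)) q k.
have g0 k : 0 <= g k by rewrite /g/= mulr_ge0 ?exprn_ge0// divr_ge0// ltW.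
have gS k : g k = c * q ^+ k + g k.+1.
  by rewrite /g /= exprS; field; rewrite gt_eqF.
have /(@nonincreasing_is_cvgn R (fun k => u k + g k)) :
    {homo (fun k => u k + g k) : n m / (n <= m)%N >-> m <= n}.
  apply/nonincreasing_seqP => k.
  by rewrite [g k]gS addrA lerD2r.
move=> /(_ _)/wrap[].
  by exists 0 => _ [k _ <-]; rewrite addr_ge0.
move=> cv; exists (limn (fun k => u k + g k)).
have cg : g k @[k --> \oo] --> 0 by apply: cvg_geometric; rewrite ger0_norm.
have := cvgB cv cg; rewrite subr0.
have -> : (fun k => u k + g k) - g = u by apply/funext => k; exact: addrK.
by apply.
Qed.

(** A strictly increasing sequence exhausts its range in order, so a limit
    along the sequence is a limit along the range seen as a set of indices. *)
Lemma cvg_within_range (R : realType) (f : nat -> R) (v : nat -> nat) (l : R) :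
  {homo v : i j / (i < j)%N} -> f (v k) @[k --> \oo] --> l ->
  f @ within [set N | exists2 k, (1 <= k)%N & N = v k] \oo --> l.
Proof.
move=> vS cv; apply/cvgrPdist_lt => e e0.
move/cvgrPdist_lt: cv => /(_ e e0)[K _ fK].
exists (v K) => // N /= vKN [k _ Nk]; rewrite Nk; apply: fK => /=.
by rewrite leqNgt; apply/negP => /vS; rewrite ltnNge -Nk vKN.
Qed.

Theorem theorem4p2 (R : realType) (p M : nat) (r : R)
    (psi : 'I_M -> 'rV[R]_p -> 'rV[R]_p) (A : set 'rV[R]_p)
    (hA : self_similar_fractal (fun _ : 'I_M => r) psi A)
    (d s : R) (hd : hausdorff_dim A = d%:E) (hs : d < s)
    (n : nat) (hn : (0 < n)%N) :
  exists l : R,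
    (fun N : nat => min_energy s A N / N%:R `^ (1 + s / d)) @
      within [set N : nat | exists2 k : nat, (1 <= k)%N & N = (M ^ k * n)%N] \oo
    --> l.
Proof.
have [d0 Mrd] := moran_equation hA hd.
have s0 : 0 <= s by rewrite ltW// (lt_trans d0).
have [M2 sim _ _ _] := hA.
have M0 : (0 < M)%N by exact: ltn_trans M2.
have /andP[r0 _] : 0 < r < 1 by case: (sim (Ordinal M0)).
have [C C0 recE] := min_energy_replicate hA s0.
have MR0 : 0 < M%:R :> R by rewrite ltr0n.
have sd1 : 1 < s / d by rewrite ltr_pdivlMr// mul1r.
(* By Moran's equation the energy and its normalization scale alike. *)
have rs : M%:R * r `^ (- s) = M%:R `^ (1 + s / d).
  rewrite powRD; last by rewrite (gt_eqF MR0) implybT.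
  rewrite powRr1 ?(ltW MR0)//; congr (_ * _).
  have -> : M%:R = r `^ (- d).
    have rd0 : r `^ d != 0 by rewrite gt_eqF// powR_gt0.
    by rewrite powRN; apply: (mulIf rd0); rewrite Mrd mulVf.
  by rewrite -powRrM; congr (_ `^ _); field; rewrite gt_eqF.
pose q : R := M%:R `^ (1 - s / d).
have q01 : 0 <= q < 1.
  rewrite powR_ge0/= /q /powR gt_eqF// -[ltRHS]expR0 ltr_expR.
  by rewrite nmulr_rlt0 ?subr_lt0// ln_gt0// ltr1n.
have [l cvl] : exists l : R,
    min_energy s A (M ^ k * n) / (M ^ k * n)%:R `^ (1 + s / d) @[k --> \oo] --> l.
  apply: (@cvg_quasi_nonincreasing _ _ (C * (M * n)%:R `^ (1 - s / d)) q) => //.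
  - by rewrite mulr_ge0// powR_ge0.
  - by move=> k; rewrite divr_ge0 ?min_energy_ge0// powR_ge0.
  move=> k; set N := (M ^ k * n)%N.
  have N0 : 0 < N%:R :> R by rewrite ltr0n muln_gt0 expn_gt0 M0.
  have -> : (M ^ k.+1 * n)%N = (M * N)%N by rewrite expnS mulnA.
  have MN0 : 0 < (M * N)%:R :> R by rewrite natrM mulr_gt0.
  rewrite ler_pdivrMr ?powR_gt0// (le_trans (recE N))//.
  rewrite mulrDl rs; apply: lerD.
    rewrite natrM powRM ?(ltW MR0) ?(ltW N0)//.
    rewrite le_eqVlt; apply/predU1P; left; field.
    by rewrite gt_eqF// powR_gt0.
  have -> : C * (M * n)%:R `^ (1 - s / d) * q ^+ k =
      C * (M * N)%:R `^ (1 - s / d).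
    rewrite -mulrA; congr (_ * _).
    rewrite /q -powR_mulrn ?powR_ge0// -powRrM mulrC [_ * k%:R]mulrC powRrM.
    by rewrite powR_mulrn// -powRM// -!natrX -!natrM mulnCA.
  rewrite -[leRHS]mulrA -powRD; last by rewrite (gt_eqF MN0) implybT.
  by rewrite addrACA addNr addr0 -[1 + 1]/(2%:R) powR_mulrn 1?mulrC // ltW.
exists l; apply: cvg_within_range cvl => i j ij.
by rewrite ltn_pmul2r// ltn_exp2l.
Qed.
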